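(* In the setting of the context, for every agent $i$ and every $x\in\mathcal{X}$, let $\nu_i^*(x)=\mathrm{VaR}_{\alpha_i}[J_i(x,\xi_i)]$. Then $$\nabla_iC_i(x)=\nabla_{x_i}L_i(x,\nu_i)\Big|_{\nu_i=\nu_i^*(x)}=\mathbb{E}_{\xi_i}\Big[\frac1{\alpha_i}\mathbf{1}\{J_i(x,\xi_i)\ge\nu_i^*(x)\}\,\nabla_iJ_i(x,\xi_i)\Big].$$
   Context: There are $N$ agents; agent $i$ chooses $x_i\in\mathcal{X}_i\subseteq\mathbb{R}^d$, a convex set of diameter at most $D$. $\mathcal{X}=\prod_{i=1}^N\mathcal{X}_i$, $x=(x_1,\dots,x_N)=(x_i,x_{-i})$. $\xi_i\in\Xi_i\subset\mathbb{R}^{n_\xi}$ is a random variable with a fixed distribution; $J_i:\mathcal{X}\times\Xi_i\to\mathbb{R}$ is the stochastic cost, convex in $x_i$ for every $x_{-i}$ and $\xi_i$, and $J_i(\cdot,\xi_i)$ is Lipschitz and differentiable for every $\xi_i$. $\nabla_i=\nabla_{x_i}$ denotes the partial gradient with respect to $x_i$, and $\|\cdot\|$ is the Euclidean norm. Standing assumptions on the costs. (A1) For each $i$, $J_i(x,\xi_i)=f_i(x_i,\xi_i)+g_i(x)$, where for every $x_i\in\mathcal{X}_i$ the random variable $f_i(x_i,\xi_i)$ is absolutely continuous and its VaR value is differentiable in $x_i$; $f_i(x_i,\xi_i)$ is convex in $x_i$ for every $\xi_i\in\Xi_i$; and, for some $m>0$, $\sum_i\langle\nabla_ig_i(x)-\nabla_ig_i(x'),x_i-x_i'\rangle\ge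 m\|x-x'\|^2$ for all $x,x'\in\mathcal{X}$. (A2) $\|\nabla_iJ_i(x,\xi_i)\|\le B$ for all $i$, $x\in\mathcal{X}$, $\xi_i\in\Xi_i$. Risk measures. For a random variable $Z$ with CDF $F$ and $\alpha\in(0,1]$, $\mathrm{VaR}_\alpha[Z]=\inf\{y:F(y)\ge1-\alpha\}$ (equal to $-\infty$ if $\alpha=1$, in which case the indicator in the claim is identically $1$), and $\mathrm{CVaR}_\alpha[Z]=\mathbb{E}[Z\mid Z\ge\mathrm{VaR}_\alpha[Z]]$ (equivalently $\min_{\nu\in\mathbb{R}}\{\nu+\frac1\alpha\mathbb{E}[Z-\nu]_+\}$, with $[z]_+=\max\{z,0\}$; for $\alpha=1$ this is $\mathbb{E}[Z]$). For risk levels $\alpha_i\in(0,1]$, $C_i(x)=\mathrm{CVaR}_{\alpha_i}[J_i(x,\xi_i)]$ and $$L_i(x,\nu_i)=\nu_i+\frac1{\alpha_i}\mathbb{E}_{\xi_i}[J_i(x,\xi_i)-\nu_i]_+,\qquad\nu_i\in\mathbb{R},$$ whose (sub)gradient in $x_i$ is $\nabla_{x_i}L_i(x,\nu_i)=\mathbb{E}_{\xi_i}\big[\frac1{\alpha_i}\mathbf{1}\{J_i(x,\xi_i)\ge\nu_i\}\nabla_iJ_i(x,\xi_i)\big]$. *)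

(* Defs.v *)
(* MathComp-Analysis. *)
From HB Require Import structures.
From mathcomp Require Import all_boot all_order all_algebra.
From mathcomp Require Import all_classical all_reals all_analysis.

Set Implicit Arguments.
Unset Strict Implicit.
Unset Printing Implicit Defensive.

Import Order.TTheory GRing.Theory Num.Theory.
Import numFieldNormedType.Exports.

Local Open Scope classical_set_scope.
Local Open Scope ring_scope.

(* Euclidean (Frobenius) structure, used both on vectors ('rV_d) and on joint
   actions ('M_(N, d)); the library norm on matrices is the max norm. *)
Definition frob {R : realType} {m n : nat} (A B : 'M[R]_(m, n)) : R :=
  \sum_(i < m) \sum_(j < n) A i j * B i j.

Definition enorm {R : realType} {m n : nat} (A : 'M[R]_(m, n)) : R :=
  Num.sqrt (frob A A).

(* f, regarded as a function on A only, is differentiable at x with gradient v: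
   f y = f x + <v, y - x> + o(y - x) as y tends to x inside A. At an interior
   point of A this is the usual gradient; at a boundary point it uses no value
   of f outside A. It determines v when A is convex with nonempty interior.
   The max norm implicit in the little-o is equivalent to enorm. *)
Definition is_gradient_on {R : realType} {m n : nat} (A : set 'M[R]_(m, n))
    (f : 'M[R]_(m, n) -> R) (x v : 'M[R]_(m, n)) : Prop :=
  (fun y => f y - f x - frob v (y - x) : R) =o_ (within A (nbhs x))
  (fun y => y - x).

(* A joint action x = (x_1, ..., x_N) is a matrix whose i-th row is x_i. *)
Definition joint {R : realType} {N d : nat} (X : 'I_N -> set 'rV[R]_d) :
    set 'M[R]_(N, d) :=
  [set x | forall i, X i (row i x)].

(* (y, x_{-i}) *)
Definition deviate {R : realType} {N d : nat} (x : 'M[R]_(N, d)) (i : 'I_N)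
    (y : 'rV[R]_d) : 'M[R]_(N, d) :=
  \matrix_(k, j) (if k == i then y 0 j else x k j).

Section risk.
Context {dO : measure_display} {O : measurableType dO} {R : realType}.
Variable P : probability O R.
Implicit Types (a : R) (Z : O -> R).

(* pushforward P Z `]-oo, y] unfolds the library's cdf, which requires Z to be
   packaged as a random variable. The infimum is taken in \bar R: it is -oo
   for a = 1. *)
Definition VaR a Z : \bar R :=
  ereal_inf [set y%:E | y in
    [set y : R | ((1 - a)%:E <= pushforward P Z `]-oo, y])%E]].

Definition tail Z (nu : \bar R) : set O := [set w | (nu <= (Z w)%:E)%E].

(* E[Z | Z >= VaR_a[Z]] *)
Definition CVaR a Z : R :=
  let T := tail Z (VaR a Z) in
  fine 'E_P[fun w => Z w * \1_T w] / fine (P T).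

(* The expectation defining CVaR a Z exists and is finite. *)
Definition CVaR_defined a Z : Prop :=
  P.-integrable (tail Z (VaR a Z)) (EFin \o Z).

Definition Laux_real a Z (nu : R) : R :=
  nu + a^-1 * fine 'E_P[fun w => Num.max (Z w - nu) 0].

(* Extended to infinite nu by its limits, so that it may be evaluated at the
   VaR also for a = 1; there, its value at -oo is E[Z]. *)
Definition Laux a Z (nu : \bar R) : R :=
  match nu with
  | r%:E => Laux_real a Z r
  | -oo%E => lim (Laux_real a Z r @[r --> -oo])
  | +oo%E => lim (Laux_real a Z r @[r --> +oo])
  end.

End risk.

(* Main.v *)
(* Write Z_y for the cost when agent i plays y and the others follow x, T for
   the tail event {Z_x >= nu}, where nu = VaR(Z_x), and v for the partial
   gradient of the cost. By convexity and (A2), y |-> Z_y is Lipschitz uniformly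
   in the noise. For alpha < 1 the law of Z_x has no atom, so P(T) = alpha and
   (Z_y - nu)_+ has gradient 1_T v at x almost surely; dominated convergence then
   differentiates L(., nu). For every event E of probability alpha and every
   real s, E[Z 1_E] / alpha <= L(Z, s), with equality when E = {Z >= s}. Used
   with E = T and with s = nu, this gives, for h the increment of the action,
     C(x) + <G, h> <= E[Z_y 1_T] / alpha <= C(y) <= L(y, nu),
   the first step because v is a subgradient. Both ends agree to first order,
   so C has gradient G; unlike the convexity of C, this squeeze works also at
   boundary points of the action set. For alpha = 1, C and L are both E[Z_y]. *)
Require Import Defs.
From HB Require Import structures.
From mathcomp Require Import all_boot all_order all_algebra.
From mathcomp Require Import all_classical all_reals all_analysis.

From mathcomp Require Import measurable_realfun ring lra.

Import Order.TTheory GRing.Theory Num.Theory.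
Import numFieldNormedType.Exports.

Local Open Scope classical_set_scope.
Local Open Scope ring_scope.

(** * Relative gradients in epsilon form, and the Frobenius pairing *)

Lemma is_gradient_onP {R : realType} {m n : nat} (A : set 'M[R]_(m, n))
    (f : 'M[R]_(m, n) -> R) (x v : 'M[R]_(m, n)) :
  is_gradient_on A f x v <->
  forall e, 0 < e -> \forall y \near x,
    A y -> `|f y - f x - frob v (y - x)| <= e * `|y - x|.
Proof. by rewrite /is_gradient_on; split=> [/eqoP|h]; [|apply/eqoP]. Qed.

Lemma frob0r {R : realType} {m n : nat} (u : 'M[R]_(m, n)) : frob u 0 = 0.
Proof.
by rewrite /frob big1// => i _; rewrite big1// => j _; rewrite mxE mulr0.
Qed.

Lemma frobZr {R : realType} {m n : nat} (t : R) (u v : 'M[R]_(m, n)) :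
  frob u (t *: v) = t * frob u v.
Proof.
rewrite /frob mulr_sumr; apply: eq_bigr => i _; rewrite mulr_sumr.
by apply: eq_bigr => j _; rewrite mxE mulrCA.
Qed.

Lemma frobZl {R : realType} {m n : nat} (t : R) (u v : 'M[R]_(m, n)) :
  frob (t *: u) v = t * frob u v.
Proof.
rewrite /frob mulr_sumr; apply: eq_bigr => i _; rewrite mulr_sumr.
by apply: eq_bigr => j _; rewrite mxE mulrA.
Qed.

Lemma frob_rV {R : realType} {n : nat} (u v : 'rV[R]_n) :
  frob u v = \sum_(j < n) u 0 j * v 0 j.
Proof. by rewrite /frob big_ord1. Qed.

Lemma entry_le_enorm {R : realType} {m n : nat} (u : 'M[R]_(m, n)) i j :
  `|u i j| <= enorm u.
Proof.
rewrite /enorm -sqrtr_sqr ler_wsqrtr// expr2 /frob (bigD1 i)//= (bigD1 j)//=.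
rewrite -addrA lerDl addr_ge0//; first by apply: sumr_ge0 => k _; exact: sqr_ge0.
by apply: sumr_ge0 => k _; apply: sumr_ge0 => l _; exact: sqr_ge0.
Qed.

Lemma normr_entry_le {R : realType} {m n : nat} (u : 'M[R]_(m, n)) i j :
  `|u i j| <= `|u|.
Proof.
by rewrite [leRHS]/Num.norm/= mx_normrE (le_bigmax _ (fun ij => `|u ij.1 ij.2|) (i, j)).
Qed.

Lemma normr_frob_le {R : realType} {n : nat} (B : R) (u v : 'rV[R]_n) :
  (forall j, `|u 0 j| <= B) -> `|frob u v| <= n%:R * B * `|v|.
Proof.
move=> uB; rewrite frob_rV (le_trans (ler_norm_sum _ _ _))//.
rewrite -mulrA mulr_natl -[leRHS](_ : \sum_(j < n) B * `|v| = _).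
  apply: ler_sum => j _; rewrite normrM ler_pM//; exact: normr_entry_le.
by rewrite sumr_const card_ord.
Qed.

(** * First-order inequalities for convex functions *)

Section convex_gradient.
Context {R : realType} {n : nat} (A : set 'rV[R]_n) (h : 'rV[R]_n -> R).
Hypothesis convA : convex_set A.
Hypothesis convh : convex_function A h.

(** At [x + t (y - x)] with small [t], the chord bounds [h] from above and the expansion at [x]
    bounds it from below; dividing by [t] leaves an arbitrarily small error. The segment stays in
    [A], so boundary points are covered. *)
Lemma convex_gradient_le x y v : A x -> A y -> is_gradient_on A h x v ->
  h x + frob v (y - x) <= h y.
Proof.
move=> Ax Ay /is_gradient_onP hv.
have [->|yx] := eqVneq y x; first by rewrite subrr frob0r addr0.
have yx0 : 0 < `|y - x| by rewrite normr_gt0 subr_eq0.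
rewrite -subr_ge0; apply/ler_addgt0Pl => e e0.
(* With this tolerance the remainder at distance [t * |y - x|] is at most [t * e], so [e] survives
   division by [t]. *)
have := hv (e / `|y - x|) (divr_gt0 e0 yx0).
move=> /nbhs_ballP[r /= r0 hr].
(* The bound 1 keeps [z] on the segment; the other bound places [z] within [r / 2] of [x]. *)
pose t := Num.min 1 (r / 2 / `|y - x|).
have t0 : 0 < t by rewrite lt_min ltr01 !divr_gt0.
have t1 : t <= 1 by rewrite ge_min lexx.
pose T : {i01 R} := Itv01 (ltW t0) t1.
pose z := x + t *: (y - x).
have zE : z = (conv T (y : convex_lmodType _) (x : convex_lmodType _)).
  by rewrite /z /conv/= scalerBr scalerBl scale1r addrCA addrA.
have Az : A z.
  apply/set_mem; rewrite zE; apply: convA; exact/mem_set.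
have hz : h z <= t * h y + (1 - t) * h x.
  by rewrite zE; apply: (convh T); exact/mem_set.
have zx : z - x = t *: (y - x) by rewrite /z addrC addKr.
have Bz : ball x r z.
  rewrite -ball_normE /= distrC zx normrZ gtr0_norm// -ltr_pdivlMr//.
  by rewrite gt_min ltr_pdivrMr// -mulrA mulVf ?gt_eqF// mulr1 ltr_pdivrMr//
    mulrDr mulr1 ltrDl r0 orbT.
have := hr z Bz Az; rewrite zx normrZ frobZr (gtr0_norm t0).
rewrite mulrCA -mulrA mulVf ?gt_eqF// mulr1 => /ler_normlP[H _].
rewrite -subr_le0 -(pmulr_rle0 _ t0).
lra.
Qed.

(** The gradient inequality based at each of the two points bounds the increment on both sides. The
    constant depends only on the dimension and [B], hence is uniform in the noise, as dominated
    convergence will require. *)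
Lemma convex_gradient_lipschitz (v : 'rV[R]_n -> 'rV[R]_n) (B : R) :
  (forall y, A y -> is_gradient_on A h y (v y)) ->
  (forall y j, A y -> `|v y 0 j| <= B) ->
  forall x y, A x -> A y -> `|h y - h x| <= n%:R * B * `|y - x|.
Proof.
move=> hv vB x y Ax Ay.
have H a b : A a -> A b -> h a - h b <= n%:R * B * `|a - b|.
  move=> Aa Ab; have := convex_gradient_le _ _ _ Aa Ab (hv a Aa).
  have /ler_normlP[+ _] := normr_frob_le B (v a) (b - a) (fun j => vB a j Aa).
  rewrite (distrC a b); lra.
by rewrite ler_norml lerNl opprB H// distrC H.
Qed.

End convex_gradient.

(** * Differentiation under the expectation *)

Section differentiation_under_expectation.
Context {dO : measure_display} {O : measurableType dO} {R : realType}.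
Variable P : probability O R.

Lemma bounded_integrable (f : O -> R) (K : R) :
  measurable_fun setT f -> (forall w, `|f w| <= K) ->
  P.-integrable setT (EFin \o f).
Proof.
move=> mf fK; apply: measurable_bounded_integrable => //.
  by rewrite -ge0_fin_numE// fin_num_measure.
exists K; split; first exact: num_real.
by move=> M KM w _ /=; rewrite (le_trans (fK w))// ltW.
Qed.

Lemma Rintegral_frob {n : nat} (v : O -> 'rV[R]_n) (u : 'rV[R]_n) (K : R) :
  (forall j, measurable_fun setT (fun w => v w 0 j)) ->
  (forall w j, `|v w 0 j| <= K) ->
  P.-integrable setT (EFin \o (fun w => frob (v w) u)) /\
  \int[P]_w frob (v w) u = frob (\row_j \int[P]_w v w 0 j) u.
Proof.
move=> mv vK.
have iv j : P.-integrable setT (EFin \o (fun w => v w 0 j * u 0 j)).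
  apply: (@bounded_integrable _ (K * `|u 0 j|)).
    exact: measurable_funM.
  by move=> w; rewrite normrM ler_wpM2r.
have e : EFin \o (fun w => frob (v w) u) =
    (fun w => \sum_(j < n) (v w 0 j * u 0 j)%:E)%E.
  by apply/funext => w /=; rewrite frob_rV sumEFin.
split; first by rewrite e; apply: integrable_sum => // j _; exact: iv.
rewrite /Rintegral frob_rV.
have -> : (\int[P]_w (frob (v w) u)%:E =
    \sum_(j < n) \int[P]_w (v w 0 j * u 0 j)%:E)%E.
  rewrite -(integral_sum measurableT)//.
  by apply: eq_integral => w _; rewrite frob_rV sumEFin.
rewrite -sum_fine; last by move=> j _; exact: (integrable_fin_num measurableT (iv j)).
apply: eq_bigr => j _; rewrite mxE -RintegralZr//.
exact: (@bounded_integrable _ K).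
Qed.

(** If the expansion failed for some [e], it would fail along a sequence in [A] tending to [x].
    Along that sequence the normalised remainders tend to 0 almost surely under a constant bound, so
    dominated convergence gives a contradiction. *)
Lemma is_gradient_on_Rintegral {n : nat} (A : set 'rV[R]_n) (x : 'rV[R]_n)
    (h : 'rV[R]_n -> O -> R) (v : O -> 'rV[R]_n) (K B : R) :
  A x ->
  (forall y, A y -> P.-integrable setT (EFin \o h y)) ->
  (forall y w, A y -> `|h y w - h x w| <= K * `|y - x|) ->
  (forall j, measurable_fun setT (fun w => v w 0 j)) ->
  (forall w j, `|v w 0 j| <= B) ->
  {ae P, forall w, is_gradient_on A (h ^~ w) x (v w)} ->
  is_gradient_on A (fun y => \int[P]_w h y w) x (\row_j \int[P]_w v w 0 j).
Proof.
move=> Ax ih hK mv vB hv; apply/is_gradient_onP; apply: contrapT.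
move=> /existsNP[e /not_implyP[e0 He]].
have /choice[y_ Hy] : forall k : nat, exists y, [/\ A y, `|y - x| < k.+1%:R^-1 &
    e * `|y - x| < `|\int[P]_w h y w - \int[P]_w h x w
                    - frob (\row_j \int[P]_w v w 0 j) (y - x)|].
  move=> k; apply: contrapT => Hk; apply: He.
  have : \forall y \near x, ball x k.+1%:R^-1 y by exact: nbhsx_ballx.
  apply: filterS => y; rewrite -ball_normE/= distrC => yx Ay.
  by rewrite leNgt; apply/negP => ?; apply: Hk; exists y.
have Ay k : A (y_ k) by case: (Hy k).
have y0 k : 0 < `|y_ k - x|.
  rewrite normr_gt0 subr_eq0; apply/eqP => yx; have [_ _] := Hy k.
  by rewrite yx !(subrr, frob0r, normr0, mulr0) ltxx.
(* The pointwise remainder divided by the length of the increment, nonzero since the violated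
   inequality is strict. *)
pose q k w := (h (y_ k) w - h x w - frob (v w) (y_ k - x)) / `|y_ k - x|.
have iv k := Rintegral_frob v (y_ k - x) _ mv vB.
have inum k : P.-integrable setT
    (EFin \o (fun w => h (y_ k) w - h x w - frob (v w) (y_ k - x))).
  exact: integrableB (integrableB measurableT (ih _ (Ay k)) (ih _ Ax)) (iv k).1.
have qE k : \int[P]_w q k w = (\int[P]_w h (y_ k) w - \int[P]_w h x w -
    frob (\row_j \int[P]_w v w 0 j) (y_ k - x)) / `|y_ k - x|.
  rewrite RintegralZr// RintegralB//; last 2 first.
  - exact: integrableB (ih _ (Ay k)) (ih _ Ax).
  - exact: (iv k).1.
  by rewrite RintegralB//; [rewrite (iv k).2|exact: ih|exact: ih].
have iq k : P.-integrable setT (EFin \o q k).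
  exact: (integrableZr measurableT (`|y_ k - x|^-1) (inum k)).
have q0 : {ae P, forall w, setT w -> (fun k => (q k w)%:E) @ \oo --> 0%E}.
  apply: filterS hv => w /is_gradient_onP hw _.
  apply/cvg_EFin; first by apply: nearW.
  apply/cvgr0Pnorm_le => d d0.
  have /nbhs_ballP[r /= r0 Hr] := hw d d0.
  have : \forall k \near \oo, k.+1%:R^-1 < r by exact: near_infty_natSinv_lt (PosNum r0).
  apply: filterS => k kr /=.
  rewrite normrM normfV normr_id ler_pdivrMr//; apply: Hr => //.
  by rewrite -ball_normE/= distrC; have [_ yk _] := Hy k; exact: lt_trans yk kr.
(* [K] bounds the difference quotient, and [n * B] the linear term relative to the max norm. *)
have qK : {ae P, forall w k, setT w -> (`|(q k w)%:E| <= (K + n%:R * B)%:E)%E}.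
  apply: aeW => w k _; rewrite abse_EFin lee_fin /q normrM normfV normr_id.
  rewrite ler_pdivrMr// mulrDl (le_trans (ler_normB _ _))//.
  by apply: lerD; [exact: hK|exact: normr_frob_le].
have [_ _] := dominated_convergence measurableT
  (fun k => measurable_int P (iq k)) (measurable_cst _) q0
  (finite_measure_integrable_cst P (K + n%:R * B) measurableT) qK.
rewrite integral0 => /fine_cvg/cvgr0Pnorm_lt/(_ _ e0).
(* A single index suffices: the mean of [q k] is below [e] in absolute value there, but exceeds [e]
   by the choice of [y_ k]. *)
case=> k _ /(_ k (leqnn k)) /=.
have [_ _] := Hy k; rewrite -ltr_pdivlMr// => Hk.
rewrite -[fine _]/(\int[P]_w q k w) qE normrM normfV normr_id => /(lt_trans Hk).
by rewrite ltxx.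
Qed.
End differentiation_under_expectation.

(** * Value at risk and the probability of its tail event *)

Section VaR_tail.
Context {dO : measure_display} {O : measurableType dO} {R : realType}.
Variable P : probability O R.
Implicit Types (a : R) (Z : O -> R).

Lemma VaR1 Z : VaR P 1 Z = -oo%E.
Proof.
apply: eq_ninfty => r; apply: ereal_inf_lbound; exists r => //=.
by rewrite subrr /pushforward measure_ge0.
Qed.

Lemma tailNy Z : tail Z -oo = setT.
Proof. by apply/seteqP; split => // w _; rewrite /tail/= leNye. Qed.

Lemma tailE Z (r : R) : tail Z r%:E = Z @^-1` `[r, +oo[.
Proof.
by apply/seteqP; split => w; rewrite /tail/= in_itv/= andbT lee_fin.
Qed.

Lemma measurable_tail Z (nu : \bar R) : measurable_fun setT Z ->
  measurable (tail Z nu).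
Proof.
move=> mZ; rewrite -[tail _ _]setTI /tail.
have mEZ : measurable_fun setT (EFin \o Z) by exact/measurable_EFinP.
exact: (emeasurable_fun_c_infty measurableT mEZ).
Qed.

Lemma abs_cont_preimage_set1 Z (c : R) :
  pushforward P Z `<< (@lebesgue_measure R) -> P (Z @^-1` [set c]) = 0.
Proof.
move/null_content_dominatesP; apply; first exact: measurable_set1.
exact: lebesgue_measure_set1.
Qed.

(** Right continuity makes the infimum attained, so the open tail has mass at most [a], and adding
    the null atom at [r] changes nothing. Below [r] open tails have mass above [a], which passes to
    the closed tail by continuity from above. *)
Lemma VaR_fin a Z : 0 < a < 1 -> measurable_fun setT Z ->
    (forall c, P (Z @^-1` [set c]) = 0) ->
  exists2 r : R, VaR P a Z = r%:E & P (tail Z r%:E) = a%:E.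
Proof.
move=> /andP[a0 a1] mZ Z0.
pose X : {RV P >-> R} := mfun_Sub (mem_set mZ).
pose S := [set y : R | ((1 - a)%:E <= cdf X y)%E].
have ccdfE y : ccdf X y = (1 - fine (cdf X y))%:E.
  have fF : cdf X y \is a fin_num by rewrite fin_num_measure.
  by rewrite EFinB fineK// -(cdf_ccdf_1 X y) addeAC subee// add0e.
have SE y : S y <-> (ccdf X y <= a%:E)%E.
  have fF : cdf X y \is a fin_num by rewrite fin_num_measure.
  by rewrite ccdfE /S/= -(fineK fF) !lee_fin/=; split => ?; lra.
have S_up y z : S y -> y <= z -> S z.
  by move=> Sy yz; apply: le_trans Sy _; exact: cdf_nondecreasing.
(* The limits 1 and 0 of the cdf make [S] nonempty because [0 < a], and not the whole line because
   [a < 1]; as [S] is upward closed, it is bounded below. *)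
have S0 : S !=set0.
  apply: contrapT => /forallNP SN.
  have : (1%:E <= (1 - a)%:E)%E.
    apply: (cvge_to_le (cvg_cdfy1 X)); apply: nearW => y.
    by rewrite leNgt; apply/negP => /ltW /SN.
  by rewrite lee_fin; lra.
have [l Sl] : exists l, ~ S l.
  apply/existsNP => ST.
  have : ((1 - a)%:E <= 0%:E)%E.
    by apply: (cvge_to_ge (cvg_cdfNy0 X)); apply: nearW.
  by rewrite lee_fin; lra.
have Slb : has_lbound S.
  exists l => y Sy; rewrite leNgt; apply/negP => /ltW yl.
  exact: Sl (S_up _ _ Sy yl).
pose r := inf S.
have Sr : S r.
  apply/SE; have rc : ccdf X y @[y --> r^'+] --> ccdf X r by exact: ccdf_right_continuous.
  apply: (cvge_to_le rc).
  near=> y; apply/SE.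
  have ry : 0 < y - r by rewrite subr_gt0.
  have [s Ss sy] := inf_adherent ry (conj S0 Slb).
  by apply: (S_up _ _ Ss); rewrite ltW// (lt_le_trans sy)// addrC subrK.
exists r; first exact: ereal_inf_EFin.
apply/eqP; rewrite eq_le; apply/andP; split.
  move/SE : Sr; apply: le_trans.
  rewrite (_ : tail Z r%:E = Z @^-1` [set r] `|` Z @^-1` `]r, +oo[).
    apply: (le_trans (measureU2 _ _ _)).
    - exact: (@measurable_funPTI _ _ _ _ X).
    - exact: (@measurable_funPTI _ _ _ _ X).
    by rewrite [X in (X + _ <= _)%E](Z0 r) add0e.
  by rewrite -preimage_setU tailE setU1itv.
(* The closed half-line is the decreasing intersection of the open ones starting at [r - 1/(k+1)],
   points which lie strictly below [inf S]. *)
rewrite tailE itvcyEbigcap preimage_bigcap.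
pose F k := Z @^-1` `]r - k.+1%:R^-1, +oo[.
have mF k : measurable (F k) by exact: (@measurable_funPTI _ _ _ _ X).
apply: (cvge_to_ge (nonincreasing_cvg_mu (F := F) _ mF _ _)).
- by rewrite -ge0_fin_numE// fin_num_measure.
- exact: bigcap_measurable.
- move=> i j ij; apply/subsetPset; apply: preimage_subset; apply: subset_itvr.
  by rewrite bnd_simp lerD2l lerN2 lef_pV2 ?posrE// ler_nat.
apply: nearW => k; rewrite leNgt; apply/negP => /ltW /SE Sk.
have := ge_inf Slb Sk; rewrite -/r lerBrDr gerDl.
by rewrite leNgt invr_gt0 ltr0Sn.
Unshelve. all: by end_near.
Qed.
End VaR_tail.

(** * The Rockafellar-Uryasev representation of CVaR *)

Section Rockafellar_Uryasev.
Context {dO : measure_display} {O : measurableType dO} {R : realType}.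
Variable P : probability O R.
Implicit Types (a : R) (Z : O -> R) (T : set O).

Lemma fine_expectation Z : fine 'E_P[Z] = \int[P]_w Z w.
Proof. by rewrite unlock. Qed.

Lemma integrable_mul_indic Z T : measurable T ->
  P.-integrable T (EFin \o Z) ->
  P.-integrable setT (EFin \o (fun w => Z w * \1_T w)).
Proof.
move=> mT /(integrable_mkcond _ mT); apply: eq_integrable => // w _ /=.
by rewrite patchE indicE; case: ifPn => _; rewrite /= (mulr1, mulr0).
Qed.

(** Integrability of [Z] is available only above [r]. Below [r] the excess is bounded by
    [|r| + |nu|], so nothing is asked of the lower tail of [Z]. *)
Lemma integrable_excess Z (r nu : R) : measurable_fun setT Z ->
  P.-integrable (tail Z r%:E) (EFin \o Z) ->
  P.-integrable setT (EFin \o (fun w => Num.max (Z w - nu) 0)).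
Proof.
move=> mZ /(integrable_mul_indic _ _ (measurable_tail _ r%:E mZ)) iZ.
have iB := integrableD measurableT (integrable_abse iZ)
  (finite_measure_integrable_cst P (`|r| + `|nu|) measurableT).
apply: le_integrable iB => //.
  apply/measurable_EFinP; apply: measurable_maxr => //.
  exact: measurable_funB.
move=> w _ /=; rewrite !lee_fin.
rewrite [leRHS]ger0_norm ?addr_ge0// ger0_norm ?le_max ?lexx ?orbT//.
rewrite ge_max; apply/andP; split; last by rewrite !addr_ge0.
rewrite indicE; have [wT|wT] := boolP (w \in _).
  rewrite mulr1.
  have := ler_norm (Z w); have := ler_norm (- nu); rewrite normrN.
  have := normr_ge0 r; lra.
have : Z w < r by rewrite ltNge; apply: contra wT => rZ; rewrite inE /tail/= lee_fin.
have := ler_norm (- nu); rewrite normrN.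
have := ler_norm r; rewrite mulr0 normr0; lra.
Qed.

Section with_event.
Context (a : R) (T : set O) (Z : O -> R) (nu : R).
Hypothesis a0 : 0 < a.
Hypothesis mT : measurable T.
Hypothesis PT : P T = a%:E.
Hypothesis iZ : P.-integrable setT (EFin \o (fun w => Z w * \1_T w)).

Let inu : P.-integrable setT (EFin \o (fun w => nu * \1_T w)).
Proof. exact: (integrableZl measurableT nu (integrable_indic P mT)). Qed.

(** Since [P T = a], subtracting [nu] on [T] costs exactly [a * nu]. The comparison with [Laux_real]
    then reduces to comparing [(Z - nu) 1_T] with the positive part of [Z - nu]. *)
Let mean_excess : a^-1 * \int[P]_w (Z w * \1_T w) =
  nu + a^-1 * \int[P]_w (Z w * \1_T w - nu * \1_T w).
Proof.
rewrite RintegralB// RintegralZl//; last exact: integrable_indic.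
rewrite [X in nu * X](_ : _ = a); last first.
  by rewrite -[RHS]/(fine a%:E) -PT /Rintegral integral_indic// setIT.
by rewrite mulrBr mulrCA mulVf ?gt_eqF// mulr1 addrC subrK.
Qed.

Lemma mean_tail_le_Laux :
  P.-integrable setT (EFin \o (fun w => Num.max (Z w - nu) 0)) ->
  a^-1 * \int[P]_w (Z w * \1_T w) <= Laux_real P a Z nu.
Proof.
move=> ie; rewrite mean_excess /Laux_real fine_expectation lerD2l.
rewrite ler_pM2l ?invr_gt0//; apply: le_Rintegral => //.
  exact: (integrableB measurableT iZ inu).
move=> w _; rewrite -mulrBl indicE le_max.
by case: (w \in T); rewrite ?mulr1 ?mulr0 lexx ?orbT.
Qed.

Lemma Laux_eq_mean_tail : T = tail Z nu%:E ->
  Laux_real P a Z nu = a^-1 * \int[P]_w (Z w * \1_T w).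
Proof.
move=> TE; rewrite mean_excess /Laux_real fine_expectation.
congr (_ + _ * _); apply: eq_Rintegral => w _; rewrite -mulrBl indicE.
have [wT|wT] := boolP (w \in T).
  have : T w by exact/set_mem.
  by rewrite TE /tail/= lee_fin mulr1 => ?; rewrite max_l// subr_ge0.
have : ~ T w by move=> /mem_set; exact/negP.
rewrite TE /tail/= lee_fin => /negP; rewrite -ltNge => Znu.
by rewrite mulr0 max_r// subr_le0 ltW.
Qed.

End with_event.

Lemma CVaR_eq_mean_tail a Z : P (tail Z (VaR P a Z)) = a%:E ->
  CVaR P a Z = a^-1 * \int[P]_w (Z w * \1_(tail Z (VaR P a Z)) w).
Proof. by move=> PT; rewrite /CVaR PT fine_expectation mulrC. Qed.

Lemma CVaR1 Z : CVaR P 1 Z = \int[P]_w Z w.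
Proof.
rewrite CVaR_eq_mean_tail VaR1 tailNy ?probability_setT// invr1 mul1r.
by apply: eq_Rintegral => w _; rewrite indicT mulr1.
Qed.

(** For [u <= 0], [u + E[(Z - u)_+]] is the mean of [max(Z, u)], which tends to [Z] as [u] tends to
    [-oo] and is dominated by [|Z|]. *)
Lemma Laux1Ny Z : P.-integrable setT (EFin \o Z) ->
  Laux P 1 Z -oo = \int[P]_w Z w.
Proof.
move=> iZ; apply: cvg_lim => //; apply/cvg_ninftyP => u uNy.
have mZ : measurable_fun setT Z by exact/measurable_EFinP/(measurable_int P iZ).
(* Truncating at [min(u k, 0)] makes the domination by [|Z|] hold for every [k], including the early
   terms where [u k] may be positive. *)
pose g k w := Num.max (Z w) (Num.min (u k) 0).
have mg k : measurable_fun setT (EFin \o g k).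
  by apply/measurable_EFinP; exact: measurable_maxr.
have LE k : u k <= 0 -> \int[P]_w g k w = Laux_real P 1 Z (u k).
  move=> uk0; rewrite /Laux_real fine_expectation invr1 mul1r.
  have ie : P.-integrable setT (EFin \o (fun w => Num.max (Z w - u k) 0)).
    apply: (integrable_excess _ (u k)) => //.
    by apply: integrableS iZ => //; exact: measurable_tail.
  rewrite -[X in X + _]mulr1 -[X in u k * X]/(fine 1%E) -(probability_setT P).
  rewrite -Rintegral_cst// -RintegralD//; last exact: finite_measure_integrable_cst.
  apply: eq_Rintegral => w _; rewrite /g (min_l uk0).
  by rewrite addr_maxr addr0 addrC subrK.
have g_cvg : {ae P, forall w, setT w -> (fun k => (g k w)%:E) @ \oo --> (Z w)%:E}.
  apply: aeW => w _; apply: cvg_near_cst.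
  have /cvgrNyPle/(_ (Z w)) := uNy; apply: filterS => k uk.
  by rewrite /g max_l// ge_min uk.
have gZ : {ae P, forall w k, setT w -> (`|(g k w)%:E| <= `|(Z w)%:E|)%E}.
  apply: aeW => w k _; rewrite lee_fin /g; have [//|Zm] := leP (Num.min (u k) 0) (Z w).
  have m0 : Num.min (u k) 0 <= 0 by rewrite ge_min lexx orbT.
  by rewrite !ler0_norm ?(ltW (lt_le_trans Zm m0))// lerN2 ltW.
have [_ _] := dominated_convergence measurableT mg (measurable_int P iZ) g_cvg
  (integrable_abse iZ) gZ.
have iZf := integrable_fin_num measurableT iZ.
rewrite -(fineK iZf) => /fine_cvg; apply: cvg_trans; apply: near_eq_cvg.
have /cvgrNyPle/(_ 0) := uNy; apply: filterS => k /LE <-.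
by [].
Qed.

End Rockafellar_Uryasev.

(** * Calculus of relative gradients *)

Section gradient_rules.
Context {R : realType} {m n : nat} (A : set 'M[R]_(m, n)).
Implicit Types (f g : 'M[R]_(m, n) -> R) (x v : 'M[R]_(m, n)).

Lemma is_gradient_on_local f g x v : A x ->
  (\forall y \near x, A y -> f y = g y) ->
  is_gradient_on A g x v -> is_gradient_on A f x v.
Proof.
move=> Ax fg /is_gradient_onP gv; apply/is_gradient_onP => e e0.
have fgx : f x = g x by exact: (nbhs_singleton fg).
by apply: (@filterS2 _ (nbhs x)) fg (gv e e0) => y fgy + Ay; rewrite fgx fgy//; exact.
Qed.

Lemma is_gradient_on_cst (c : R) x : is_gradient_on A (cst c) x 0.
Proof.
apply/is_gradient_onP => e e0; apply: filterE => y _.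
by rewrite -[X in frob X](scale0r 0) frobZl mul0r !subrr normr0 mulr_ge0// ltW.
Qed.

Lemma is_gradient_on_affine f x v (c k : R) : is_gradient_on A f x v ->
  is_gradient_on A (fun y => c + k * f y) x (k *: v).
Proof.
have [->|k0] := eqVneq k 0.
  move=> _; rewrite scale0r.
  by under eq_fun do rewrite mul0r addr0; exact: is_gradient_on_cst.
move=> /is_gradient_onP fv; apply/is_gradient_onP => e e0.
have ek : 0 < e / `|k| by rewrite divr_gt0// normr_gt0.
have := fv _ ek; apply: (@filterS _ (nbhs x)) => y + Ay => /(_ Ay) H.
rewrite frobZl opprD addrACA subrr add0r -mulrBr -mulrBr normrM mulrC -ler_pdivlMr ?normr_gt0//.
by rewrite mulrAC.
Qed.

(** The remainder of [f] is nonnegative and at most that of [g], so it inherits the little-o. *)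
Lemma is_gradient_on_squeeze f g x v : f x = g x ->
  (forall y, A y -> f x + frob v (y - x) <= f y) ->
  (forall y, A y -> f y <= g y) ->
  is_gradient_on A g x v -> is_gradient_on A f x v.
Proof.
move=> fgx lf fg /is_gradient_onP gv; apply/is_gradient_onP => e e0.
have := gv e e0; apply: (@filterS _ (nbhs x)) => y + Ay => /(_ Ay); apply: le_trans.
have := lf y Ay; have := fg y Ay; rewrite fgx => H1 H2.
by rewrite !ger0_norm; lra.
Qed.

End gradient_rules.

(** Away from the kink, the Lipschitz bound keeps [f y] on the same side of [r] as [f x] for [y] in
    [A] near [x]; there the positive part is either [f - r] or 0. *)
Lemma is_gradient_on_excess {R : realType} {n : nat} (A : set 'rV[R]_n)
    (f : 'rV[R]_n -> R) (x v : 'rV[R]_n) (K r : R) : A x ->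
  (forall y, A y -> `|f y - f x| <= K * `|y - x|) -> f x != r ->
  is_gradient_on A f x v ->
  is_gradient_on A (fun y => Num.max (f y - r) 0) x ((r <= f x)%R%:R *: v).
Proof.
move=> Ax fK fxr fv.
have f_near : \forall y \near x, A y -> `|f y - f x| < `|f x - r|.
  (* Using [|K| + 1] keeps the radius well defined and positive whatever the sign of [K]. *)
  have d0 : 0 < `|f x - r| / (`|K| + 1).
    by rewrite divr_gt0 ?ltr_wpDl// normr_gt0 subr_eq0.
  have : \forall y \near x, ball x (`|f x - r| / (`|K| + 1)) y by exact: nbhsx_ballx.
  apply: (@filterS _ (nbhs x)) => y; rewrite -ball_normE/= distrC ltr_pdivlMr ?ltr_wpDl// => H Ay.
  apply: le_lt_trans H; apply: le_trans (fK _ Ay) _; rewrite mulrC ler_wpM2l//.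
  by rewrite (le_trans (ler_norm _))// lerDl.
have [rf|fr] := leP r (f x).
  rewrite scale1r; have := is_gradient_on_affine A f x v (- r) 1 fv.
  rewrite scale1r; apply: is_gradient_on_local => //.
  move: f_near; apply: (@filterS _ (nbhs x)) => y + Ay => /(_ Ay).
  rewrite (ger0_norm (_ : 0 <= f x - r)) ?subr_ge0// mul1r => /ltr_normlP[H _].
  by rewrite addrC max_l//; lra.
rewrite scale0r; apply: is_gradient_on_local (is_gradient_on_cst A 0 x) => //.
move: f_near; apply: (@filterS _ (nbhs x)) => y + Ay => /(_ Ay).
rewrite (ltr0_norm (_ : f x - r < 0)) ?subr_lt0// => /ltr_normlP[_ H].
by rewrite max_r//; lra.
Qed.

(** * The gradient of CVaR for a parametrised random cost *)

Section CVaR_gradient.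
Context {dO : measure_display} {O : measurableType dO} {R : realType}.
Variable P : probability O R.
Context {n : nat} (A : set 'rV[R]_n) (x : 'rV[R]_n).
Variables (Z : 'rV[R]_n -> O -> R) (v : O -> 'rV[R]_n) (a K B : R).
Hypothesis Ax : A x.
Hypothesis mZ : forall y, A y -> measurable_fun setT (Z y).
Hypothesis Z_atomless : forall y c, A y -> P (Z y @^-1` [set c]) = 0.
Hypothesis Z_defined : forall y, A y -> CVaR_defined P a (Z y).
Hypothesis Z_lipschitz : forall y w, A y -> `|Z y w - Z x w| <= K * `|y - x|.
Hypothesis Z_subgradient : forall y w, A y ->
  Z x w + frob (v w) (y - x) <= Z y w.
Hypothesis mv : forall j, measurable_fun setT (fun w => v w 0 j).
Hypothesis vB : forall w j, `|v w 0 j| <= B.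
Hypothesis Zv : forall w, is_gradient_on A (Z ^~ w) x (v w).

Lemma mean_gradient : a = 1 ->
  is_gradient_on A (fun y => \int[P]_w Z y w) x (\row_j \int[P]_w v w 0 j).
Proof.
move=> a1; apply: (is_gradient_on_Rintegral P A x Z v K B) => //; last exact: aeW.
by move=> y Ay; have := Z_defined y Ay; rewrite /CVaR_defined a1 VaR1 tailNy.
Qed.

Let nu := VaR P a (Z x).
Let T := tail (Z x) nu.
Let G : 'rV[R]_n := \row_j fine 'E_P[fun w => a^-1 * \1_T w * v w 0 j].

Let mT : measurable T. Proof. exact/measurable_tail/mZ. Qed.

Let mvT j : measurable_fun setT (fun w => (\1_T w *: v w) 0 j).
Proof.
under eq_fun do rewrite mxE.
by apply: measurable_funM => //; exact: measurable_indic.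
Qed.

Let vTB w j : `|(\1_T w *: v w) 0 j| <= B.
Proof.
rewrite mxE indicE; case: (w \in T); rewrite ?mul1r// mul0r normr0.
exact: le_trans (vB w j).
Qed.

(** This is the form produced by differentiating under the expectation and then applying the affine
    rule. *)
Let GE : G = a^-1 *: \row_j \int[P]_w (\1_T w *: v w) 0 j.
Proof.
apply/rowP => j; rewrite !mxE fine_expectation -RintegralZl//; last first.
  by apply: bounded_integrable => // w; exact: vTB.
by apply: eq_Rintegral => w _; rewrite mxE mulrA.
Qed.

Let frobG u : frob G u = a^-1 * \int[P]_w frob (\1_T w *: v w) u.
Proof. by rewrite GE frobZl (Rintegral_frob P _ u B mvT vTB).2. Qed.

Lemma CVaR_Laux_gradient_lt1 : 0 < a < 1 ->
  is_gradient_on A (fun y => CVaR P a (Z y)) x G /\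
  is_gradient_on A (fun y => Laux P a (Z y) nu) x G.
Proof.
move=> a01; have a0 : 0 < a by case/andP: a01.
have VaRP y : A y -> exists2 r : R, VaR P a (Z y) = r%:E & P (tail (Z y) r%:E) = a%:E.
  by move=> Ay; apply: VaR_fin => // [|c]; [exact: mZ|exact: Z_atomless].
have [r nuE PT] := VaRP x Ax.
have TE : T = tail (Z x) r%:E by rewrite /T /nu nuE.
have iexc y s : A y -> P.-integrable setT (EFin \o (fun w => Num.max (Z y w - s) 0)).
  move=> Ay; have [q qE _] := VaRP y Ay.
  by apply: (integrable_excess P _ q) => //; [exact: mZ|rewrite -qE; exact: Z_defined].
have itail y : A y -> P.-integrable setT
    (EFin \o (fun w => Z y w * \1_(tail (Z y) (VaR P a (Z y))) w)).
  move=> Ay; apply: integrable_mul_indic; last exact: Z_defined.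
  exact/measurable_tail/mZ.
(* The event [T] belongs to [Z x], not to [Z y]; on [T] the Lipschitz bound controls [Z y] by
   [|Z x|] plus a constant. *)
have iZT y : A y -> P.-integrable setT (EFin \o (fun w => Z y w * \1_T w)).
  move=> Ay.
  have iB := integrableD measurableT (integrable_abse (itail x Ax))
    (finite_measure_integrable_cst P `|K * `|y - x| | measurableT).
  apply: le_integrable iB => //.
    apply/measurable_EFinP; apply: measurable_funM; first exact: mZ.
    exact: measurable_indic.
  move=> w _ /=; rewrite -/nu -/T !lee_fin [leRHS]ger0_norm ?addr_ge0//.
  rewrite indicE; case: (w \in T); last by rewrite !mulr0 normr0 add0r.
  rewrite !mulr1; have := ler_normD (Z x w) (Z y w - Z x w).
  rewrite [Z x w + _]addrC subrK; have := Z_lipschitz y w Ay.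
  have := ler_norm (K * `|y - x|); lra.
(* At its own VaR, the tail event has probability [a] and realises equality in the comparison of
   tail mean and [Laux_real]. *)
have CE y s : A y -> VaR P a (Z y) = s%:E ->
    CVaR P a (Z y) = Laux_real P a (Z y) s.
  move=> Ay ys; have [q qE Pq] := VaRP y Ay.
  have qs : q = s by apply: EFin_inj; rewrite -qE -ys.
  rewrite CVaR_eq_mean_tail; last by rewrite qE.
  rewrite (Laux_eq_mean_tail P a (tail (Z y) (VaR P a (Z y))))// ?ys//.
  - exact/measurable_tail/mZ.
  - by rewrite -qs.
  - by rewrite -ys; exact: itail.
have LG : is_gradient_on A (fun y => Laux P a (Z y) nu) x G.
  rewrite /nu nuE /Laux /Laux_real GE; apply: is_gradient_on_affine.
  under eq_fun do rewrite fine_expectation.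
  apply: (is_gradient_on_Rintegral P A x (fun y w => Num.max (Z y w - r) 0)
    (fun w => \1_T w *: v w) K B) => //.
  - by move=> y Ay; exact: iexc.
  - move=> y w Ay; apply: le_trans (Z_lipschitz y w Ay).
    rewrite ler_norml; have := ler_norm (Z y w - Z x w).
    have := ler_norm (- (Z y w - Z x w)); rewrite normrN.
    have := normr_ge0 (Z y w - Z x w).
    (* The positive part is 1-Lipschitz. *)
    by case: (leP (Z y w - r) 0) => ?; case: (leP (Z x w - r) 0) => ?;
      move=> *; apply/andP; split; lra.
  (* The exceptional null set is where [Z x] sits exactly at the kink. *)
  exists (Z x @^-1` [set r]); split => //.
  - by rewrite -[X in measurable X]setTI; apply: mZ.
  - exact: Z_atomless.
  move=> w /=; apply: contra_notP => Zr.
  rewrite (_ : \1_T w = (r <= Z x w)%R%:R).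
    by apply: (is_gradient_on_excess A (Z ^~ w) _ _ K) => // [y Ay|];
      [exact: Z_lipschitz|exact/eqP].
  by rewrite indicE TE; congr ((nat_of_bool _)%:R); apply/idP/idP; rewrite inE /tail/= lee_fin.
split => //; apply: is_gradient_on_squeeze LG.
- by rewrite /nu nuE; exact: CE.
(* Lower bound: integrate the subgradient inequality over [T], then compare the resulting tail mean
   with [Laux_real] at [s], the VaR of [Z y], where it equals the CVaR. *)
- move=> y Ay; have [s sE _] := VaRP y Ay.
  rewrite (CE y s)//; apply: le_trans (mean_tail_le_Laux P a T (Z y) s a0 mT _ _ _).
  + have -> : CVaR P a (Z x) = a^-1 * \int[P]_w (Z x w * \1_T w).
      by apply: CVaR_eq_mean_tail; rewrite nuE.
    rewrite frobG -mulrDr ler_pM2l ?invr_gt0//.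
    have ifrob := (Rintegral_frob P _ (y - x) B mvT vTB).1.
    rewrite -RintegralD; [|by []|exact: (iZT x Ax)|exact: ifrob].
    apply: le_Rintegral => //.
    * exact: (integrableD measurableT (iZT x Ax) ifrob).
    * exact: iZT.
    move=> w _; rewrite frobZl mulrC -mulrDr mulrC.
    by rewrite ler_wpM2r ?Z_subgradient// indicE.
  + by rewrite TE.
  + exact: iZT.
  + exact: iexc.
(* Upper bound: the roles are exchanged, with the tail event of [Z y] and the level [r] of [Z x]. *)
- move=> y Ay; have [s sE Ps] := VaRP y Ay.
  rewrite /nu nuE CVaR_eq_mean_tail; last by rewrite sE.
  apply: mean_tail_le_Laux => //.
  + exact/measurable_tail/mZ.
  + by rewrite sE.
  + exact: itail.
  + exact: iexc.
Qed.

(** At [a = 1] the VaR is [-oo] and the tail is the whole space, so on [A] both functions are the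
    plain mean. *)
Lemma CVaR_Laux_gradient : 0 < a <= 1 ->
  is_gradient_on A (fun y => CVaR P a (Z y)) x G /\
  is_gradient_on A (fun y => Laux P a (Z y) nu) x G.
Proof.
rewrite le_eqVlt => /andP[a0 /predU1P[a1|a1]]; last first.
  by apply: CVaR_Laux_gradient_lt1; rewrite a0.
have -> : G = \row_j \int[P]_w v w 0 j.
  apply/rowP => j; rewrite !mxE fine_expectation.
  apply: eq_Rintegral => w _; rewrite /T /nu a1 VaR1 tailNy indicT.
  by rewrite invr1 !mul1r.
split; apply: is_gradient_on_local (mean_gradient a1) => //; apply: filterE => y Ay.
  by rewrite a1 CVaR1.
rewrite /nu a1 VaR1 Laux1Ny//.
by have := Z_defined y Ay; rewrite /CVaR_defined a1 VaR1 tailNy.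
Qed.

End CVaR_gradient.

(** * Unilateral deviations, and application to the game *)

Section deviate.
Context {R : realType} {N d : nat}.
Implicit Types (X : 'I_N -> set 'rV[R]_d) (x : 'M[R]_(N, d)) (i : 'I_N).

Lemma row_deviate x i (y : 'rV[R]_d) : row i (deviate x i y) = y.
Proof. by apply/rowP => j; rewrite !mxE eqxx. Qed.

Lemma deviate_row x i : deviate x i (row i x) = x.
Proof. by apply/matrixP => k j; rewrite !mxE; case: eqP => // ->. Qed.

Lemma deviate_deviate x i (y z : 'rV[R]_d) :
  deviate (deviate x i y) i z = deviate x i z.
Proof. by apply/matrixP => k j; rewrite !mxE; case: eqP. Qed.

Lemma joint_deviate X x i (y : 'rV[R]_d) :
  joint X x -> X i y -> joint X (deviate x i y).
Proof.
move=> Xx Xy k; have [->|ki] := eqVneq k i; first by rewrite row_deviate.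
rewrite (_ : row k _ = row k x)//.
by apply/rowP => j; rewrite !mxE (negbTE ki).
Qed.

End deviate.

Theorem lemma2 (R : realType) (N d nxi : nat)
  (* action sets *)
  (X : 'I_N -> set 'rV[R]_d) (D : R)
  (convX : forall i, convex_set (X i))
  (diamX : forall i (y z : 'rV[R]_d), X i y -> X i z -> enorm (y - z) <= D)
  (* noise *)
  (dO : measure_display) (O : measurableType dO) (P : probability O R)
  (Xi : 'I_N -> set (nxi.-tuple R))
  (xi : 'I_N -> {RV P >-> nxi.-tuple R})
  (xi_in : forall i w, Xi i (xi i w))
  (* costs and their partial gradients *)
  (J : 'I_N -> 'M[R]_(N, d) -> nxi.-tuple R -> R)
  (gradJ : 'I_N -> 'M[R]_(N, d) -> nxi.-tuple R -> 'rV[R]_d)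
  (J_convex : forall i x u, joint X x -> Xi i u ->
     convex_function (X i) (fun y => J i (deviate x i y) u))
  (J_lipschitz : forall i u, Xi i u -> exists K : R,
     forall x x', joint X x -> joint X x' ->
       `|J i x u - J i x' u| <= K * enorm (x - x'))
  (J_differentiable : forall i x u, joint X x -> Xi i u ->
     exists G : 'M[R]_(N, d), is_gradient_on (joint X) (fun z => J i z u) x G)
  (J_gradient : forall i x u, joint X x -> Xi i u ->
     is_gradient_on (X i) (fun y => J i (deviate x i y) u) (row i x)
       (gradJ i x u))
  (gradJ_measurable : forall i x j, joint X x ->
     measurable_fun setT (fun w => gradJ i x (xi i w) 0 j))
  (* A1 *)
  (alpha : 'I_N -> R) (alpha01 : forall i, 0 < alpha i <= 1)
  (f : 'I_N -> 'rV[R]_d -> nxi.-tuple R -> R)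
  (g : 'I_N -> 'M[R]_(N, d) -> R) (gradg : 'I_N -> 'M[R]_(N, d) -> 'rV[R]_d)
  (J_split : forall i x u, joint X x -> Xi i u ->
     J i x u = f i (row i x) u + g i x)
  (f_measurable : forall i y, X i y ->
     measurable_fun setT (fun w => f i y (xi i w)))
  (f_abs_cont : forall i y, X i y ->
     pushforward P (fun w => f i y (xi i w)) `<< (@lebesgue_measure R))
  (f_VaR_differentiable : forall i y, X i y -> exists v : 'rV[R]_d,
     is_gradient_on (X i)
       (fun z => fine (VaR P (alpha i) (fun w => f i z (xi i w)))) y v)
  (f_convex : forall i u, Xi i u -> convex_function (X i) (fun y => f i y u))
  (g_gradient : forall i x, joint X x ->
     is_gradient_on (X i) (fun y => g i (deviate x i y)) (row i x) (gradg i x))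
  (m : R) (m_gt0 : 0 < m)
  (g_monotone : forall x x', joint X x -> joint X x' ->
     \sum_(i < N) frob (gradg i x - gradg i x') (row i x - row i x')
       >= m * enorm (x - x') ^+ 2)
  (* A2 *)
  (B : R)
  (gradJ_bounded : forall i x u, joint X x -> Xi i u ->
     enorm (gradJ i x u) <= B)
  (C_defined : forall i x, joint X x ->
     CVaR_defined P (alpha i) (fun w => J i x (xi i w))) :
  let cost i x := fun w => J i x (xi i w) in
  let C i x := CVaR P (alpha i) (cost i x) in
  let L i x nu := Laux P (alpha i) (cost i x) nu in
  forall (i : 'I_N) (x : 'M[R]_(N, d)), joint X x ->
  let nu := VaR P (alpha i) (cost i x) in
  let G : 'rV[R]_d := \row_j fine 'E_P[fun w =>
    (alpha i)^-1 * \1_(tail (cost i x) nu) w * gradJ i x (xi i w) 0 j] in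
  is_gradient_on (X i) (fun y => C i (deviate x i y)) (row i x) G /\
  is_gradient_on (X i) (fun y => L i (deviate x i y) nu) (row i x) G.
Proof.
move=> cost C L i x Xx nu G.
have Xy y : X i y -> joint X (deviate x i y) by exact: joint_deviate.
have costE y w : X i y ->
    cost i (deviate x i y) w = f i y (xi i w) + g i (deviate x i y).
  by move=> Ay; rewrite /cost J_split ?row_deviate//; exact: Xy.
have grad_entry y u j : X i y -> Xi i u -> `|gradJ i (deviate x i y) u 0 j| <= B.
  move=> Ay Xu; apply: le_trans (entry_le_enorm _ _ _) _.
  exact: gradJ_bounded (Xy y Ay) Xu.
(* Deviating twice is deviating once, so the gradient given at the current row of any joint action
   is available at every [y]. *)
have grad y u : X i y -> Xi i u -> is_gradient_on (X i)
    (fun z => J i (deviate x i z) u) y (gradJ i (deviate x i y) u).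
  move=> Ay Xu; have := J_gradient i _ u (Xy y Ay) Xu.
  by rewrite row_deviate; under eq_fun do rewrite deviate_deviate.
have Xr : X i (row i x) by exact: Xx.
(* The Lipschitz constant [d * B] comes from the entrywise gradient bound [B] and the max norm on
   [d] coordinates. *)
have := @CVaR_Laux_gradient _ _ _ P _ (X i) (row i x)
  (fun y => cost i (deviate x i y)) (fun w => gradJ i x (xi i w))
  (alpha i) (d%:R * B) B Xr.
rewrite !deviate_row; apply => //.
- move=> y Ay.
  rewrite (_ : cost _ _ = (fun w => f i y (xi i w) + g i (deviate x i y))).
    by apply: measurable_funD; [exact: f_measurable|exact: measurable_cst].
  by apply/funext => w; exact: costE.
- move=> y c Ay.
  (* For a fixed action [g] is constant in the noise, so the law of the cost is a translate of the
     law of [f] and has no atom. *)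
  rewrite (_ : _ @^-1` _ = (fun w => f i y (xi i w)) @^-1`
      [set c - g i (deviate x i y)]).
    exact: abs_cont_preimage_set1 (f_abs_cont i y Ay).
  apply/seteqP; split => w /=; rewrite costE// => h.
    by rewrite -h addrK.
  by rewrite h subrK.
- by move=> y Ay; exact: C_defined (Xy y Ay).
- move=> y w Ay; rewrite -[in X in _ - X](deviate_row x i).
  apply: (convex_gradient_lipschitz (X i) (fun z => J i (deviate x i z) (xi i w))
    (convX i) (J_convex i x _ Xx (xi_in i w))
    (fun z => gradJ i (deviate x i z) (xi i w))) => // [z Az|z j Az].
    exact: grad.
  exact: grad_entry.
- move=> y w Ay; rewrite -[in X in X + _](deviate_row x i).
  apply: (convex_gradient_le (X i) (fun z => J i (deviate x i z) (xi i w))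
    (convX i) (J_convex i x _ Xx (xi_in i w))) => //.
  exact: J_gradient.
- by move=> j; exact: gradJ_measurable.
- by move=> w j; have := grad_entry (row i x) (xi i w) j Xr (xi_in i w);
    rewrite deviate_row.
- by move=> w; exact: J_gradient.
Qed.
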